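(* Let $a \in \mathbb{R}^{+}$ (that is, $a$ is a real number with $a>0$). Then $$\beta(a) = \sum_{k=0}^{\infty} \frac{(-1)^{k}}{a+k}.$$
   Context: The incomplete beta function is the one-variable function defined for real $a>0$ by $\beta(a) = \int_{0}^{1} \frac{x^{a-1}}{1+x}\,dx$ (the integral converges for $a>0$). The infinite series is understood as the limit of its partial sums (it converges only conditionally). *)

(* Defs.v *)
From Stdlib Require Import Reals Lra.
From Coquelicot Require Import Coquelicot.

Open Scope R_scope.

(** The integrand [x^(a-1) / (1+x)], meaningful for [x > 0]: [Rpower x y] is
    [exp (y * ln x)], so its value at [x <= 0] is a convention. *)
Definition beta_integrand (a x : R) : R := Rpower x (a - 1) / (1 + x).

(** For [0 < a < 1] the integrand is unbounded near [0], hence the improper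
    integral: the limit as [e] decreases to [0] of the integral over [[e, 1]]. *)
Definition beta (a : R) : R :=
  RInt_gen (beta_integrand a) (at_right 0) (at_point 1).

(** [RInt_gen] returns an unspecified value for a divergent integral. The rest of
    the file proves convergence for [a > 0], writing the integrand as
    [x^(a-1) - x^a / (1+x)], whose second term extends continuously to [0]. *)

Definition pow0 (a x : R) : R := if Rle_dec x 0 then 0 else Rpower x a.

Lemma pow0_pos (a x : R) : 0 < x -> pow0 a x = Rpower x a.
Proof. intros Hx; unfold pow0; destruct (Rle_dec x 0); lra. Qed.

Lemma locally_pos (x : R) : 0 < x -> locally x (fun y => 0 < y).
Proof. apply (open_gt 0). Qed.

Lemma is_derive_pow0 (a x : R) :
  0 < x -> is_derive (pow0 a) x (a * Rpower x (a - 1)).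
Proof.
  intros Hx.
  apply is_derive_ext_loc with (fun y => Rpower y a).
  - apply (filter_imp (fun y => 0 < y)); [|now apply locally_pos].
    intros y Hy; symmetry; now apply pow0_pos.
  - apply is_derive_Reals; now apply derivable_pt_lim_power.
Qed.

Lemma continuous_pow0 (a x : R) : 0 < a -> continuous (pow0 a) x.
Proof.
  intros Ha.
  destruct (Rtotal_order x 0) as [Hx|[->|Hx]].
  - apply continuous_ext_loc with (fun _ => 0); [|apply continuous_const].
    apply (filter_imp (fun y => y < 0)); [|now apply (open_lt 0)].
    intros y Hy; unfold pow0; destruct (Rle_dec y 0); lra.
  - apply filterlim_locally; intros eps.
    assert (H0 : pow0 a 0 = 0) by (unfold pow0; destruct (Rle_dec 0 0); lra).
    exists (mkposreal (Rpower eps (/ a)) (exp_pos _)); intros y Hy.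
    rewrite H0.
    change (Rabs (y - 0) < Rpower eps (/ a)) in Hy.
    change (Rabs (pow0 a y - 0) < eps).
    rewrite Rminus_0_r in *.
    unfold pow0; destruct (Rle_dec y 0) as [_|Hy0].
    + rewrite Rabs_R0; apply cond_pos.
    + rewrite Rabs_pos_eq by (left; apply exp_pos).
      rewrite Rabs_pos_eq in Hy by lra.
      replace (pos eps) with (Rpower (Rpower eps (/ a)) a).
      * apply Rlt_Rpower_l; lra.
      * rewrite Rpower_mult, Rinv_l, Rpower_1 by (try apply cond_pos; lra).
        reflexivity.
  - apply (ex_derive_continuous (pow0 a)).
    eexists; now apply is_derive_pow0.
Qed.

Lemma ex_RInt_gen_beta (a : R) :
  0 < a -> ex_RInt_gen (beta_integrand a) (at_right 0) (at_point 1).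
Proof.
  intros Ha.
  set (g x := pow0 a x * / (1 + Rabs x)).
  assert (Hg : forall x, continuous g x).
  { intros x; apply (continuous_mult (pow0 a)).
    - now apply continuous_pow0.
    - apply continuous_comp with (g := Rinv).
      + apply (continuous_plus (fun _ => 1) Rabs);
          [apply continuous_const | apply continuous_Rabs].
      + apply continuous_Rinv; generalize (Rabs_pos x); lra. }
  assert (HIg : forall b, is_RInt g 0 b (RInt g 0 b)).
  { intros b; apply (RInt_correct g), ex_RInt_continuous.
    intros z _; apply Hg. }
  set (F x := pow0 a x * / a - RInt g 0 x).
  assert (HF0 : continuous F 0).
  { apply (continuous_minus (fun x => pow0 a x * / a)).
    - apply (continuous_mult (pow0 a)); [now apply continuous_pow0|].
      apply continuous_const.
    - apply (continuous_RInt_1 g 0).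
      now apply filter_forall. }
  assert (HdF : forall x, 0 < x -> is_derive F x (beta_integrand a x)).
  { intros x Hx.
    replace (beta_integrand a x) with (a * Rpower x (a - 1) * / a - g x).
    - apply (is_derive_minus (fun x => pow0 a x * / a)).
      + apply (is_derive_scal_l (pow0 a) x (a * Rpower x (a - 1)) (/ a)); now apply is_derive_pow0.
      + apply (is_derive_RInt g _ 0); [now apply filter_forall | apply Hg].
    - unfold g, beta_integrand.
      rewrite pow0_pos, (Rabs_pos_eq x) by lra.
      replace (Rpower x a) with (x * Rpower x (a - 1)); [field; lra|].
      rewrite <- (Rpower_1 x) at 1 by lra.
      rewrite <- Rpower_plus; f_equal; lra. }
  assert (Hc : forall x, 0 < x -> continuous (beta_integrand a) x).
  { intros x Hx; apply (ex_derive_continuous (beta_integrand a)).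
    unfold beta_integrand, Rpower; auto_derive; lra. }
  exists (F 1 - F 0).
  intros P HP.
  assert (HP' : filterlim (fun e => F 1 - F e) (at_right 0)
                  (locally (F 1 - F 0))).
  { apply (filterlim_filter_le_1 (G := at_right 0) (F := locally 0)).
    - apply filter_le_within.
    - apply (continuous_minus (fun _ => F 1)); [apply continuous_const | exact HF0]. }
  exists (fun e => 0 < e /\ P (F 1 - F e)) (fun b => b = 1).
  - apply filter_and; [|now apply HP'].
    exists (mkposreal 1 Rlt_0_1); now intros.
  - reflexivity.
  - intros e b [He HPe] ->; simpl.
    exists (F 1 - F e); split; [|exact HPe].
    assert (Hpos : forall x, Rmin e 1 <= x <= Rmax e 1 -> 0 < x).
    { intros x [Hx _]; unfold Rmin in Hx; destruct (Rle_dec e 1); lra. }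
    apply (is_RInt_derive F); intros x Hx; [apply HdF | apply Hc]; auto.
Qed.

(* Main.v *)
Require Import Defs.
From Stdlib Require Import Reals Lra.
From Coquelicot Require Import Coquelicot.
Open Scope R_scope.

(** Since [x^(a-1) = x^(a-1) / (1+x) + x^a / (1+x)], integrating over [(0, 1]]
    gives the functional equation [beta a + beta (a+1) = 1/a]
    ([beta_functional_equation]).  Iterating it shows that the partial sum up
    to [k = n] differs from [beta a] by [beta (a+n+1)] up to sign
    ([sum_n_beta_remainder]).  As [beta] is nonnegative, the same equation
    yields [0 <= beta b <= 1/b], so the remainder tends to [0].  This avoids
    exchanging the geometric series of [1/(1+x)] with the integral, which
    absolute convergence cannot justify: the integrals of the absolute values
    add up to the divergent sum of the [1/(a+k)]. *)

Lemma at_right_at_point_pos_le :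
  filter_prod (at_right 0) (at_point 1)
    (fun ab : R * R => 0 < fst ab <= snd ab).
Proof.
  exists (fun e => 0 < e <= 1) (fun b => b = 1).
  - exists (mkposreal 1 Rlt_0_1); intros e He H0; split; [exact H0|].
    change (Rabs (e - 0) < 1) in He.
    rewrite Rminus_0_r, Rabs_pos_eq in He; lra.
  - reflexivity.
  - now intros e b He ->.
Qed.

(** The antiderivative is taken to be the continuous extension [pow0 a] of
    [x^a], divided by [a]: its limit at [0+] is then its value [0] there. *)
Lemma is_RInt_gen_Rpower (a : R) :
  0 < a ->
  is_RInt_gen (fun x => Rpower x (a - 1)) (at_right 0) (at_point 1) (/ a).
Proof.
  intros Ha.
  set (F x := pow0 a x * / a).
  assert (HdF : forall x, 0 < x -> is_derive F x (Rpower x (a - 1))).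
  { intros x Hx.
    replace (Rpower x (a - 1)) with (a * Rpower x (a - 1) * / a) by (field; lra).
    apply (is_derive_scal_l (pow0 a) x (a * Rpower x (a - 1)) (/ a)).
    now apply is_derive_pow0. }
  assert (Hpos : forall (P : R -> Prop), (forall x, 0 < x -> P x) ->
            filter_prod (at_right 0) (at_point 1)
              (fun ab : R * R => forall x,
                 Rmin (fst ab) (snd ab) <= x <= Rmax (fst ab) (snd ab) -> P x)).
  { intros P HP.
    eapply filter_imp; [|exact at_right_at_point_pos_le].
    intros [e b] [He Heb] x [Hx _]; simpl in *.
    rewrite Rmin_left in Hx by exact Heb; apply HP; lra. }
  assert (H0 : F 0 = 0) by (unfold F, pow0; destruct (Rle_dec 0 0); lra).
  assert (H1 : F 1 = / a).
  { unfold F; rewrite pow0_pos by lra.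
    unfold Rpower; rewrite ln_1, Rmult_0_r, exp_0; lra. }
  replace (/ a) with (F 1 - F 0) by lra.
  apply is_RInt_gen_ext with (f := Derive F).
  - eapply filter_imp; [|apply (Hpos (fun x => Derive F x = Rpower x (a - 1)))].
    + intros ab H x Hx; apply H; lra.
    + intros x Hx; now apply is_derive_unique, HdF.
  - apply is_RInt_gen_Derive.
    + apply Hpos; intros x Hx; eexists; now apply HdF.
    + apply Hpos; intros x Hx.
      apply continuous_ext_loc with (fun y => Rpower y (a - 1)).
      * apply (filter_imp (fun y => 0 < y)); [|now apply locally_pos].
        intros y Hy; symmetry; now apply is_derive_unique, HdF.
      * apply (ex_derive_continuous (fun y => Rpower y (a - 1))).
        unfold Rpower; auto_derive; lra.
    + apply (filterlim_filter_le_1 (G := at_right 0) (F := locally 0)).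
      * apply filter_le_within.
      * apply (continuous_mult (pow0 a)); [now apply continuous_pow0|].
        apply continuous_const.
    + intros P HP; exact (locally_singleton _ _ HP).
Qed.

Lemma is_RInt_gen_beta (a : R) :
  0 < a -> is_RInt_gen (beta_integrand a) (at_right 0) (at_point 1) (beta a).
Proof.
  intros Ha; apply (RInt_gen_correct (V := R_CompleteNormedModule)).
  now apply ex_RInt_gen_beta.
Qed.

Lemma beta_integrand_split (a x : R) :
  0 < x -> beta_integrand a x + beta_integrand (a + 1) x = Rpower x (a - 1).
Proof.
  intros Hx; unfold beta_integrand.
  replace (a + 1 - 1) with (a - 1 + 1) by ring.
  rewrite Rpower_plus, Rpower_1 by exact Hx.
  field; lra.
Qed.

Lemma beta_functional_equation (a : R) :
  0 < a -> beta a + beta (a + 1) = / a.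
Proof.
  intros Ha.
  assert (Hsum : is_RInt_gen (fun x => Rpower x (a - 1))
                   (at_right 0) (at_point 1) (plus (beta a) (beta (a + 1)))).
  { apply (is_RInt_gen_ext (V := R_NormedModule)
             (fun x => plus (beta_integrand a x) (beta_integrand (a + 1) x)));
      [|apply (is_RInt_gen_plus (V := R_NormedModule));
        apply is_RInt_gen_beta; lra].
    eapply filter_imp; [|exact at_right_at_point_pos_le].
    intros [e b] [He Heb] x [Hx _]; simpl in *.
    rewrite Rmin_left in Hx by exact Heb.
    apply beta_integrand_split; lra. }
  change (plus (beta a) (beta (a + 1)) = / a).
  rewrite <- (is_RInt_gen_unique (V := R_CompleteNormedModule) _ _ Hsum).
  apply (is_RInt_gen_unique (V := R_CompleteNormedModule)).
  now apply is_RInt_gen_Rpower.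
Qed.

Lemma beta_nonneg (a : R) : 0 < a -> 0 <= beta a.
Proof.
  intros Ha.
  (* A nonnegative integrand is bounded in norm by itself, hence so is its
     integral. *)
  apply Rle_trans with (norm (beta a)); [apply norm_ge_0|].
  apply (RInt_gen_norm (V := R_CompleteNormedModule)
           (Fa := at_right 0) (Fb := at_point 1)
           (beta_integrand a) (beta_integrand a)).
  - eapply filter_imp; [|exact at_right_at_point_pos_le].
    intros ab H; apply H.
  - eapply filter_imp; [|exact at_right_at_point_pos_le].
    intros ab [He _] x [Hx _].
    change (Rabs (beta_integrand a x) <= beta_integrand a x).
    rewrite Rabs_pos_eq; [apply Rle_refl|].
    unfold beta_integrand; apply Rlt_le, Rdiv_lt_0_compat; [apply exp_pos | lra].
  - now apply is_RInt_gen_beta.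
  - now apply is_RInt_gen_beta.
Qed.

(** In [beta b + beta (b + 1) = 1/b] both terms are nonnegative. *)
Lemma beta_le_inv (b : R) : 0 < b -> beta b <= / b.
Proof.
  intros Hb.
  rewrite <- beta_functional_equation by exact Hb.
  assert (0 <= beta (b + 1)) by (apply beta_nonneg; lra).
  lra.
Qed.

(** The functional equation makes the sum telescope:
    [(-1)^k / (a+k) = (-1)^k beta (a+k) - (-1)^(k+1) beta (a+k+1)]. *)
Lemma sum_n_beta_remainder (a : R) (n : nat) :
  0 < a ->
  sum_n (fun k : nat => (-1) ^ k / (a + INR k)) n =
  beta a - (-1) ^ S n * beta (a + INR (S n)).
Proof.
  intros Ha; induction n as [|n IH].
  - rewrite sum_O; simpl.
    rewrite Rplus_0_r; unfold Rdiv.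
    rewrite <- (beta_functional_equation a) by exact Ha; ring.
  - rewrite sum_Sn, IH; change plus with Rplus; cbv beta.
    match goal with |- ?l = ?r => change (@eq R l r) end.
    rewrite (S_INR (S n)).
    replace (a + (INR (S n) + 1)) with (a + INR (S n) + 1) by ring.
    change ((-1) ^ S (S n)) with (-1 * (-1) ^ S n).
    unfold Rdiv; rewrite <- beta_functional_equation.
    + ring.
    + generalize (pos_INR (S n)); lra.
Qed.

Lemma is_lim_seq_beta_remainder (a : R) :
  0 < a ->
  is_lim_seq (fun n => (-1) ^ n * beta (a + INR n)) 0.
Proof.
  intros Ha.
  apply is_lim_seq_abs_0.
  apply is_lim_seq_le_le with (fun _ => 0) (fun n => / (a + INR n)).
  - intros n.
    assert (Hn : 0 < a + INR n) by (generalize (pos_INR n); lra).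
    split; [apply Rabs_pos|].
    rewrite Rabs_mult, pow_1_abs, Rmult_1_l.
    rewrite Rabs_pos_eq by now apply beta_nonneg.
    now apply beta_le_inv.
  - apply is_lim_seq_const.
  - apply (is_lim_seq_inv _ p_infty); [|discriminate].
    apply (is_lim_seq_plus _ _ a p_infty);
      [apply is_lim_seq_const | apply is_lim_seq_INR | reflexivity].
Qed.

Theorem proposition2p1 (a : R) (ha : 0 < a) :
  is_series (fun k : nat => (-1) ^ k / (a + INR k)) (beta a).
Proof.
  change (is_lim_seq (sum_n (fun k : nat => (-1) ^ k / (a + INR k))) (beta a)).
  apply is_lim_seq_ext with
    (fun n => beta a - (-1) ^ S n * beta (a + INR (S n))).
  - intros n; symmetry; now apply sum_n_beta_remainder.
  - replace (beta a) with (beta a - 0) at 1 by ring.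
    apply is_lim_seq_minus'; [apply is_lim_seq_const|].
    apply (is_lim_seq_incr_1 (fun n => (-1) ^ n * beta (a + INR n))).
    now apply is_lim_seq_beta_remainder.
Qed.
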